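(* Let $\rho_2:=\sqrt{5+2\sqrt{3}}=2.9093\ldots<3$, and let $B^d$ denote the closed Euclidean ball of unit radius in $\mathbb{R}^d$. Then for every $d\ge 1$, $$f(B^d)\geq \left(2^d+\rho_2^d\right)^{-1}.$$
   Context: For measurable $E\subseteq\mathbb{R}^d$, $|E|$ denotes Lebesgue measure. A symmetric convex body $K\subseteq\mathbb{R}^d$ is the closed unit ball of a norm on $\mathbb{R}^d$. The constant $f(K)$ is the largest $c\ge 0$ such that every finite collection $\mathcal{C}$ of translates of $K$ admits a sub-collection $\mathcal{S}\subseteq\mathcal{C}$ of pairwise disjoint sets with $$\Big|\bigcup_{K'\in\mathcal{S}}K'\Big|\ge c\,\Big|\bigcup_{K'\in\mathcal{C}}K'\Big|.$$ *)

(* Defs.v *)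
From HB Require Import structures.
From mathcomp Require Import all_boot all_order all_algebra.
From mathcomp Require Import all_classical all_reals all_analysis.
Set Implicit Arguments.
Unset Strict Implicit.
Unset Printing Implicit Defensive.
Import Order.TTheory GRing.Theory Num.Theory.
Local Open Scope classical_set_scope.
Local Open Scope ring_scope.

Section lebesgue_tuple.
Context (R : realType).
Local Notation RT := (measurableTypeR R).

Definition tuple_cons n (p : RT * n.-tuple RT) : n.+1.-tuple RT :=
  [tuple of p.1 :: p.2].

Lemma measurable_tuple_cons n :
  measurable_fun [set: RT * n.-tuple RT] (@tuple_cons n).
Proof. exact: measurable_cons. Qed.

Section successor.
Context n (mu : {sigma_finite_measure set (n.-tuple RT) -> \bar R}).

Definition lebesgue_cons : set (n.+1.-tuple RT) -> \bar R :=
  pushforward (@lebesgue_measure R \x mu)%E (@tuple_cons n).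

Let lebesgue_cons0 : lebesgue_cons set0 = 0%E.
Proof. by rewrite /lebesgue_cons /pushforward preimage_set0 measure0. Qed.

Let lebesgue_cons_ge0 A : (0 <= lebesgue_cons A)%E.
Proof. by rewrite /lebesgue_cons /pushforward measure_ge0. Qed.

Let lebesgue_cons_sigma_additive : semi_sigma_additive lebesgue_cons.
Proof.
pose m : {measure set (RT * n.-tuple RT)%type -> \bar R} :=
  (@lebesgue_measure R \x mu)%E.
move=> F mF tF mUF; rewrite /lebesgue_cons /pushforward preimage_bigcup.
have mP A : measurable A -> measurable (@tuple_cons n @^-1` A).
  by move=> mA; rewrite -[X in measurable X]setTI; exact: measurable_tuple_cons.
apply: (measure_semi_sigma_additive (s := m)).
- by move=> k; exact: mP.
- apply/trivIsetP => /= i j _ _ ij; rewrite -preimage_setI.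
  by move/trivIsetP : tF => /(_ _ _ _ _ ij) ->//; rewrite preimage_set0.
- by rewrite -preimage_bigcup; exact: mP.
Qed.

HB.instance Definition _ := isMeasure.Build _ _ _ lebesgue_cons
  lebesgue_cons0 lebesgue_cons_ge0 lebesgue_cons_sigma_additive.

Let lebesgue_cons_sigma_finite : sigma_finite setT lebesgue_cons.
Proof.
have /sigma_finiteP[F [TF ndF Foo]] := sigma_finiteT (@lebesgue_measure R).
have /sigma_finiteP[G [TG ndG Goo]] := sigma_finiteT mu.
pose u (t : n.+1.-tuple RT) : RT * n.-tuple RT :=
  (thead t, [tuple of behead t]).
have mu_ : measurable_fun setT u.
  by apply/measurable_fun_pair; [exact: measurable_tnth|exact: measurable_behead].
have tuK : cancel (@tuple_cons n) u.
  by move=> [x t]; congr (_, _); exact: val_inj.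
have mFG k : measurable (F k `*` G k).
  by apply: measurableX; [case: (Foo k)|case: (Goo k)].
exists (fun k => u @^-1` (F k `*` G k)).
  rewrite -preimage_bigcup; apply/esym/seteqP; split => // t _.
  have [k _ Fk] : (\bigcup_k F k) (u t).1 by rewrite -TF.
  have [l _ Gl] : (\bigcup_k G k) (u t).2 by rewrite -TG.
  exists (maxn k l) => //; split.
  - by move: Fk; exact/subsetPset/ndF/leq_maxl.
  - by move: Gl; exact/subsetPset/ndG/leq_maxr.
move=> k; split.
  by rewrite -[X in measurable X]setTI; exact: mu_.
rewrite /lebesgue_cons /pushforward -comp_preimage.
rewrite (_ : u \o _ = id) ?preimage_id; last exact/funext.
have [[mFk Fk] [mGk Gk]] := (Foo k, Goo k).
by rewrite product_measure1E// lte_mul_pinfty// ge0_fin_numE.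
Qed.

HB.instance Definition _ := Measure_isSigmaFinite.Build _ _ _ lebesgue_cons
  lebesgue_cons_sigma_finite.

End successor.

Let dirac_nil_sigma_finite :
  sigma_finite setT (@dirac _ (0.-tuple RT) [tuple] R).
Proof.
by apply: fin_num_fun_sigma_finite => [|A _]; rewrite ?measure0// diracE.
Qed.

HB.instance Definition _ := Measure_isSigmaFinite.Build _ _ _
  (@dirac _ (0.-tuple RT) [tuple] R) dirac_nil_sigma_finite.

(* The n-fold product of the one-dimensional Lebesgue measure. *)
Fixpoint lebesgue_tuple n : {sigma_finite_measure set (n.-tuple RT) -> \bar R} :=
  if n is m.+1 then lebesgue_cons (lebesgue_tuple m) else \d_[tuple].

Lemma lebesgue_tuple_box n (A : 'I_n -> set RT) :
  (forall i, measurable (A i)) ->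
  lebesgue_tuple n [set t | forall i, A i (tnth t i)] =
  (\prod_(i < n) lebesgue_measure (A i))%E.
Proof.
elim: n A => [|n IHn] A mA.
  by rewrite big_ord0/= diracE mem_set//= => -[].
rewrite big_ord_recl -IHn//= /lebesgue_cons /pushforward -product_measure1E//.
  congr product_measure1; apply/seteqP; split => [[x t]/= xt|[x t]/= [Ax At] i].
    split; first exact: (xt ord0).
    by move=> i; have := xt (lift ord0 i); rewrite tnthS.
  by case: (unliftP ord0 i) => [j|] ->; rewrite ?tnthS.
rewrite (_ : [set _ | _] = \bigcap_(i in [set` 'I_n])
    ((fun t => tnth t i) @^-1` A (lift ord0 i))).
  apply: fin_bigcap_measurable => // i _.
  by rewrite -[X in measurable X]setTI; apply: measurable_tnth.
by apply/seteqP; split => t /= h i; [move=> _|]; exact: h.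
Qed.

End lebesgue_tuple.

Section covering_constant.
Context (R : realType) (d : nat).
Implicit Types (K : set 'rV[R]_d) (c : R).

(* Rows are identified with tuples; as for any library measure, the value is
   meaningful on measurable sets only. *)
Definition vol (E : set 'rV[R]_d) : \bar R :=
  lebesgue_tuple R d [set t | E (\row_i tnth t i)].

Definition translate K (x : 'rV[R]_d) : set 'rV[R]_d := [set x + y | y in K].

Definition covering_ratio K c : Prop :=
  0 <= c /\
  forall C : set (set 'rV[R]_d),
    finite_set C -> (forall A, C A -> exists x, A = translate K x) ->
  exists S : set (set 'rV[R]_d),
    [/\ S `<=` C,
        trivIset S id &
        (c%:E * vol (\bigcup_(A in C) A) <= vol (\bigcup_(A in S) A))%E].

(* The supremum is attained (fconst_ratio) and is the largest ratio when K has
   positive finite volume (fconst_max). *)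
Definition fconst K : R := sup [set c | covering_ratio K c].

Definition euclidean_ball : set 'rV[R]_d :=
  [set x | Num.sqrt (\sum_(i < d) x 0 i ^+ 2) <= 1].

Lemma covering_ratio0 K : covering_ratio K 0.
Proof.
split=> // C _ _; exists set0; split=> //.
by rewrite mul0e /vol measure_ge0.
Qed.

Lemma covering_ratio_le1 K c : (0 < vol K < +oo)%E -> covering_ratio K c -> c <= 1.
Proof.
case/andP=> K0 Koo [c0 /(_ [set K] (finite_set1 _))].
have K1 : forall A, [set K] A -> exists x, A = translate K x.
  move=> A ->; exists 0; rewrite /translate.
  by under eq_imagel do rewrite add0r; rewrite image_id.
move=> /(_ K1)[S [SK _]].
rewrite bigcup_set1.
have KE : vol K = (fine (vol K))%:E by rewrite fineK// ge0_fin_numE// ltW.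
have k0 : 0 < fine (vol K) by rewrite -lte_fin -KE.
have [->|->] := subset_set1 SK.
  rewrite bigcup_set0 {2}/vol measure0 KE -EFinM lee_fin => h.
  by apply: le_trans ler01; rewrite -(pmulr_lle0 _ k0).
by rewrite bigcup_set1 KE -EFinM lee_fin ger_pMl.
Qed.

Lemma fconst_ratio K : covering_ratio K (fconst K).
Proof.
have f0 : 0 <= fconst K.
  have [[_ ub]|/sup_out f00] := pselect (has_sup [set c | covering_ratio K c]).
    exact/ub_le_sup/covering_ratio0.
  by rewrite /fconst f00.
split=> // C finC CK.
pose P (S : set (set 'rV[R]_d)) := S `<=` C /\ trivIset S id.
pose g (S : set (set 'rV[R]_d)) := vol (\bigcup_(A in S) A).
have g_ge0 S : (0 <= g S)%E by rewrite /g /vol measure_ge0.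
have [S0 [S0C S0d] S0max] : exists2 S, P S & forall S', P S' -> (g S' <= g S)%E.
  have /finite_seqP[s Cs] := finC.
  pose sub (m : (size s).-tuple bool) : set (set 'rV[R]_d) := [set` mask m s].
  have subP S : S `<=` C -> exists m, S = sub m.
    move=> SC; exists [tuple of [seq `[< S A >] | A <- in_tuple s]].
    apply/seteqP; split=> A; rewrite /sub/= -filter_mask mem_filter.
      by move=> SA; apply/andP; split; [exact/asboolP|move: (SC _ SA); rewrite Cs].
    by case/andP => /asboolP.
  have [m0 m00] := subP set0 (@sub0set _ C).
  have Pm0 : `[< P (sub m0) >] by apply/asboolP; rewrite -m00; split.
  case: (@arg_maxP _ _ _ m0 (fun m => `[< P (sub m) >]) (g \o sub) Pm0).
  move=> m /asboolP Pm mmax; exists (sub m) => // S [SC Sd].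
  have [n Sn] := subP _ SC; rewrite Sn; apply: mmax.
  by apply/asboolP; rewrite -Sn; split.
exists S0; split=> //; rewrite -/(g S0) -/(g C).
have gC c : covering_ratio K c -> (c%:E * g C <= g S0)%E.
  case=> _ /(_ C finC CK)[S [SC Sd SE]].
  by apply: le_trans SE _; apply: S0max.
have fle b : (forall c, covering_ratio K c -> c <= b) -> fconst K <= b.
  by move=> h; apply: ge_sup => //; exists 0; exact: covering_ratio0.
have := g_ge0 S0; have := g_ge0 C; case: (g C) gC => [v| |]//= gC;
  case: (g S0) gC => [m| |]//= gC; rewrite ?lee_fin ?leey//.
- move=> v0 m0.
  have [v00|vN0] := eqVneq v 0; first by rewrite v00 mulr0.
  have vgt0 : 0 < v by rewrite lt0r vN0.
  rewrite -ler_pdivlMr//; apply: fle => c /gC.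
  by rewrite -EFinM lee_fin ler_pdivlMr.
- move=> _ m0; suff -> : fconst K = 0 by rewrite mul0e lee_fin.
  apply/eqP; rewrite eq_le f0 andbT; apply: fle => c /gC.
  by rewrite leNgt => h; rewrite leNgt; apply: contra h => c0; rewrite gt0_muley ?lte_fin ?ltry.
Qed.

Lemma fconst_max K c : (0 < vol K < +oo)%E -> covering_ratio K c -> c <= fconst K.
Proof.
move=> K0 Kc; apply: ub_le_sup => //; exists 1 => b.
exact: covering_ratio_le1.
Qed.

End covering_constant.
Arguments euclidean_ball : clear implicits.

Definition rho2 (R : realType) : R := Num.sqrt (5 + 2 * Num.sqrt 3).

(* Main.v *)
(* Let S be a largest subset of the set X of centres whose points are pairwise
   more than 2 apart, so that every y in X has a neighbour in S, i.e. a point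
   of S at distance at most 2.  If y has two neighbours in S, the parallelogram
   law puts the unit ball around y inside the union of the two balls of radius
   rho2 around them.  Otherwise y belongs to the cluster of its unique neighbour
   x; two points of the cluster of x are at most 2 apart, since otherwise they
   could replace x in S.  The union of the unit balls around the points of
   a cluster thus has diameter at most 4, and volume at most 2^d |B| by the
   isodiametric inequality.  Altogether the union of all balls has volume
   at most |S| (2^d + rho2^d) |B|.
   The isodiametric inequality follows from |A| |B| <= |C|^2 whenever C contains
   (A - B) / 2, which is proved by induction on the dimension: the volumes of
   the sections satisfy the hypothesis of the one-dimensional Prekopa-Leindler
   inequality, itself a consequence of one-dimensional Brunn-Minkowski applied
   to superlevel sets. *)
Require Import Defs.
From mathcomp Require Import all_boot all_order all_algebra.
From mathcomp Require Import all_classical all_reals all_analysis.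
From mathcomp Require Import measurable_realfun ring lra.
Set Implicit Arguments.
Unset Strict Implicit.
Unset Printing Implicit Defensive.
Import Order.TTheory GRing.Theory Num.Theory.
Local Open Scope classical_set_scope.
Local Open Scope ring_scope.

(** * Lebesgue measure on the line: affine maps and Brunn-Minkowski *)

Lemma measurable_affine {R : realType} (r c : R) :
  measurable_fun [set: measurableTypeR R]
    (fun x => r * x + c : measurableTypeR R).
Proof.
apply: (@measurable_funD _ _ R setT (fun x => r * x) (fun=> c)) => //.
exact: (@measurable_funM _ _ R setT (fun=> r) id).
Qed.

(** Uniqueness of Lebesgue measure: for a positive factor, the rescaled pushforward has the right
    value on half-open intervals. A negative factor is reduced to its absolute value by the
    invariance under reflection. *)
Lemma lebesgue_measure_affine (R : realType) (r c : R) (A : set R) :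
  r != 0 -> measurable A ->
  lebesgue_measure ((fun x => r * x + c) @^-1` A) =
  (`|r|^-1%:E * lebesgue_measure A)%E.
Proof.
have pos (s : R) B : 0 < s -> measurable B ->
    lebesgue_measure ((fun x => s * x + c) @^-1` B) =
    (s^-1%:E * lebesgue_measure B)%E.
  move=> s0 mB; have s_ge0 : 0 <= s by exact: ltW.
  pose phi (x : measurableTypeR R) : measurableTypeR R := s * x + c.
  pose m : {measure set (measurableTypeR R) -> \bar R} :=
    mscale (NngNum s_ge0) (pushforward lebesgue_measure phi).
  have -> : lebesgue_measure B = m (measurable_affine s c) B.
    apply: lebesgue_measure_unique => //= _ [[a b]] _ <-.
    rewrite /m /mscale /pushforward/=.
    rewrite [X in (_ = _ * lebesgue_measure X)%E](_ : _ =
        `](a - c) / s, (b - c) / s]%classic); last first.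
      apply/seteqP; split=> x /=; rewrite !in_itv/= ltr_pdivrMr// ler_pdivlMr//;
        by rewrite ltrBlDr lerBrDr mulrC.
    rewrite !lebesgue_measure_itv/= !lte_fin ltr_pM2r ?invr_gt0//.
    rewrite ltrD2r; case: ifPn => _; last by rewrite mule0.
    by rewrite -!EFinB -EFinM; congr EFin; field; rewrite gt_eqF.
  by rewrite /m /mscale /pushforward/= muleA -EFinM mulVf ?mul1e// gt_eqF.
move=> r0 mA; have [rlt0|rgt0|/eqP] := ltgtP r 0; last by rewrite (negbTE r0).
  have mB : measurable ((fun x => `|r| * x + c) @^-1` A).
    rewrite -[X in measurable X]setTI.
    exact: (measurable_affine `|r| c measurableT mA).
  rewrite -pos ?normr_gt0// -[RHS]lebesgue_measureN//.
  rewrite /pushforward; congr (lebesgue_measure _); apply/funext => x /=.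
  by rewrite ltr0_norm// mulrNN.
by rewrite gtr0_norm// pos.
Qed.

(* One-dimensional Brunn-Minkowski, in the form adapted to [X - Y]: for
   [a] near [sup X] and [b] near [sup Y], the sets [(X - b) / 2] and
   [(a - Y) / 2] meet only near [(a - b) / 2]. *)
Lemma lebesgue_measure_half_diff (R : realType) (M : R) (X Y Z : set R) :
  measurable X -> measurable Y -> measurable Z ->
  X !=set0 -> Y !=set0 ->
  X `<=` [set x | x <= M] -> Y `<=` [set x | x <= M] ->
  (forall x y, X x -> Y y -> Z ((x - y) / 2)) ->
  (lebesgue_measure X + lebesgue_measure Y <= 2%:E * lebesgue_measure Z)%E.
Proof.
move=> mX mY mZ X0 Y0 XM YM XYZ.
apply/lee_addgt0Pr => e e0.
have e20 : 0 < e / 2 by lra.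
have supX : has_sup X by split => //; exists M.
have supY : has_sup Y by split => //; exists M.
have [a Xa aX] := sup_adherent e20 supX.
have [b Yb bY] := sup_adherent e20 supY.
(* Each truncation loses at most [e / 2]. As [X1] keeps [a] while [Y1] stays strictly below [b], the
   half-size copies [U] and [V] below lie in [z <= (a - b) / 2] and [z > (a - b) / 2], hence are
   disjoint. *)
pose X1 := X `&` [set` `]-oo, a]].
pose Y1 := Y `&` [set` `]-oo, b[].
have mX1 : measurable X1 by exact: measurableI.
have mY1 : measurable Y1 by exact: measurableI.
have XX1 : (lebesgue_measure X <= lebesgue_measure X1 + (e / 2)%:E)%E.
  apply: (@le_trans _ _ (lebesgue_measure (X1 `|` [set` `]a, a + e / 2]]))).
    apply: le_measure; rewrite ?inE//; first exact: measurableU.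
    move=> x Xx; have [xa|ax] := leP x a; first by left; split.
    right; rewrite /= in_itv/= ax/=.
    have := ub_le_sup supX.2 Xx; lra.
  apply: le_trans (measureU2 _ _ _) _ => //.
  apply: leeD => //=.
  by rewrite lebesgue_measure_itv/= lte_fin ltrDl e20 -EFinB lee_fin; lra.
have YY1 : (lebesgue_measure Y <= lebesgue_measure Y1 + (e / 2)%:E)%E.
  apply: (@le_trans _ _ (lebesgue_measure (Y1 `|` [set` `[b, b + e / 2]]))).
    apply: le_measure; rewrite ?inE//; first exact: measurableU.
    move=> x Yx; have [bx|xb] := leP b x; last by left; split.
    right; rewrite /= in_itv/= bx/=.
    have := ub_le_sup supY.2 Yx; lra.
  apply: le_trans (measureU2 _ _ _) _ => //.
  apply: leeD => //=.
  by rewrite lebesgue_measure_itv/= lte_fin ltrDl e20 -EFinB lee_fin; lra.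
pose U := (fun z : R => 2 * z + b) @^-1` X1.
pose V := (fun z : R => - 2 * z + a) @^-1` Y1.
have mU : measurable U.
  by rewrite -[U]setTI; exact: (measurable_affine 2 b measurableT mX1).
have mV : measurable V.
  by rewrite -[V]setTI; exact: (measurable_affine (- 2) a measurableT mY1).
have UVE : (lebesgue_measure X1 + lebesgue_measure Y1 =
    2%:E * lebesgue_measure (U `|` V))%E.
  rewrite measureU//; last first.
    rewrite -subset0 => z [] [_] /=; rewrite in_itv/= => za [_].
    by rewrite /= in_itv/= => zb; lra.
  rewrite /= !lebesgue_measure_affine//.
  rewrite normrN normr_nat -ge0_muleDr// muleA -EFinM divff ?mul1e//.
have UVZ : U `|` V `<=` Z.
  move=> z [] [/= zX _].
    by have := XYZ _ _ zX Yb; congr Z; field.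
  by have := XYZ _ _ Xa zX; congr Z; field.
apply: (le_trans (leeD XX1 YY1)).
rewrite addeACA UVE -EFinD -splitr leeD2r// lee_pmul2l//.
by apply: le_measure; rewrite ?inE//; exact: measurableU.
Qed.

(** * Layer-cake formula and the comparison of integrals by superlevel sets *)

Section layer_cake.
Local Open Scope ereal_scope.
Context d (T : measurableType d) (R : realType).
Variable m : {sigma_finite_measure set T -> \bar R}.
Variables (f : T -> R) (mf : measurable_fun [set: T] f).

Let subgraph : set (T * measurableTypeR R) :=
  [set p | (0 <= p.2 < f p.1)%R].

Let measurable_subgraph : measurable subgraph.
Proof.
rewrite (_ : subgraph =
    ((fun p : T * measurableTypeR R => (0 <= p.2)%R) @^-1` [set true]) `&`
    ((fun p : T * measurableTypeR R => (p.2 < f p.1)%R) @^-1` [set true])).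
  apply: measurableI; rewrite -[X in measurable X]setTI.
    exact: (@measurable_fun_ler _ _ R setT (fun=> 0%R) snd).
  apply: (@measurable_fun_ltr _ _ R setT snd (f \o fst)) => //.
  exact: measurableT_comp.
by apply/seteqP; split=> p /andP.
Qed.

Lemma measurable_fun_layer :
  measurable_fun [set: R] (fun s => m [set x | (0 <= s < f x)%R]).
Proof.
have := measurable_fun_ysection m measurable_subgraph.
congr (measurable_fun _ _); apply/funext => s /=; congr (m _).
by apply/seteqP; split=> x; rewrite /ysection/= inE.
Qed.

Lemma measurable_layer s : measurable [set x | (0 <= s < f x)%R].
Proof.
have := measurable_ysection s measurable_subgraph.
congr measurable.
by apply/seteqP; split=> x; rewrite /ysection/= inE.
Qed.

(** Tonelli for the indicator of the region under the graph: its sections are the intervals [[0, f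
    x[] in one direction and the layers in the other. Layers at negative heights are empty, so [s]
    may range over the whole line. *)
Lemma ge0_integral_layer_cake : (forall x, 0 <= f x)%R ->
  \int[m]_x (f x)%:E =
  \int[lebesgue_measure]_s m [set x | (0 <= s < f x)%R].
Proof.
move=> f0.
have := indic_fubini_tonelli m (@lebesgue_measure R) measurable_subgraph.
rewrite indic_fubini_tonelli_FE// indic_fubini_tonelli_GE// => fg.
transitivity (\int[m]_x (lebesgue_measure \o xsection subgraph) x).
  apply: eq_integral => x _ /=.
  rewrite (_ : xsection _ _ = [set` `[0%R, f x[]).
    rewrite lebesgue_measure_itv/= lte_fin sube0.
    by case: ltP => // fx0; congr EFin; apply/le_anti; rewrite fx0 f0.
  by apply/seteqP; split=> s; rewrite /xsection/= inE/= in_itv.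
rewrite fg; apply: eq_integral => s _ /=; congr (m _).
by apply/seteqP; split=> x; rewrite /ysection/= inE.
Qed.

End layer_cake.

(* For functions of supremum 1 the superlevel sets at each height in [0, 1[
   are nonempty, so one-dimensional Brunn-Minkowski applies to each. *)
Lemma integral_half_diff_normalized (R : realType) (M : R) (f g h : R -> R) :
  measurable_fun setT f -> measurable_fun setT g -> measurable_fun setT h ->
  (forall x, 0 <= f x <= 1) -> (forall x, 0 <= g x <= 1) ->
  (forall x, 0 <= h x) ->
  (forall x, M < x -> f x = 0) -> (forall x, M < x -> g x = 0) ->
  (forall t, t < 1 -> exists x, t < f x) ->
  (forall t, t < 1 -> exists x, t < g x) ->
  (forall x y, f x * g y <= h ((x - y) / 2) ^+ 2) ->
  (\int[lebesgue_measure]_x (f x)%:E + \int[lebesgue_measure]_x (g x)%:E <=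
   2%:E * \int[lebesgue_measure]_x (h x)%:E)%E.
Proof.
move=> mf mg mh f01 g01 h0 fM gM f1 g1 fgh.
rewrite !ge0_integral_layer_cake//; first last.
- by move=> x; case/andP: (f01 x).
- by move=> x; case/andP: (g01 x).
rewrite -ge0_integralD//; [|exact: measurable_fun_layer..].
rewrite -ge0_integralZl//; last exact: measurable_fun_layer.
apply: ge0_le_integral => //.
- by move=> s _; rewrite adde_ge0.
- by apply: emeasurable_funD; exact: measurable_fun_layer.
- by apply: measurable_funeM; exact: measurable_fun_layer.
move=> s _.
have empty (k : R -> R) : (forall x, 0 <= k x <= 1) -> ~~ (0 <= s < 1) ->
    [set x | 0 <= s < k x] = set0.
  move=> k01 s01; rewrite -subset0 => x /= /andP[s0 sk].
  case/negP: s01; rewrite s0/=; apply: lt_le_trans sk _.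
  by case/andP: (k01 x).
(* Outside [[0, 1[] the layers of [f] and [g] are both empty and the left side is 0. *)
have [/andP[s0 s1]|s01] := boolP (0 <= s < 1); last first.
  by rewrite (empty f)// (empty g)// measure0 adde0 mule_ge0.
have sub (k : R -> R) : (forall x, M < x -> k x = 0) ->
    [set x | 0 <= s < k x] `<=` [set x | x <= M].
  move=> kM x /= /andP[_ sk]; rewrite leNgt; apply/negP => /kM kx.
  by move: sk; rewrite kx ltNge s0.
apply: (@lebesgue_measure_half_diff _ M); [exact: measurable_layer..| | | | |].
- by have [x sx] := f1 _ s1; exists x; rewrite /= s0.
- by have [x sx] := g1 _ s1; exists x; rewrite /= s0.
- exact: sub.
- exact: sub.
move=> x y /= /andP[_ sf] /andP[_ sg]; rewrite s0/=.
(* Squaring reduces the goal to [s ^+ 2 < f x * g y]. *)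
rewrite -(@ltr_pXn2r _ 2)// ?nnegrE//.
apply: lt_le_trans (fgh x y); rewrite expr2; exact: ltr_pM.
Qed.

(** * Sections of sets of tuples, bounding cubes, half differences *)

Section tuple_sections.
Local Open Scope ereal_scope.
Context (R : realType) (n : nat).
Local Notation RT := (measurableTypeR R).

Definition tuple_section (A : set (n.+1.-tuple RT)) (x : RT) :
    set (n.-tuple RT) :=
  [set t | A (tuple_cons (x, t))].

Lemma tuple_sectionE A x :
  tuple_section A x = xsection (@tuple_cons R n @^-1` A) x.
Proof. by apply/seteqP; split=> t; rewrite /xsection/= inE. Qed.

Lemma measurable_tuple_cons_preimage (A : set (n.+1.-tuple RT)) :
  measurable A -> measurable (@tuple_cons R n @^-1` A).
Proof.
by move=> mA; rewrite -[X in measurable X]setTI; exact: measurable_tuple_cons.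
Qed.

Lemma measurable_tuple_section A x :
  measurable A -> measurable (tuple_section A x).
Proof.
move=> mA; rewrite tuple_sectionE; apply: measurable_xsection.
exact: measurable_tuple_cons_preimage.
Qed.

Lemma lebesgue_tupleS A :
  lebesgue_tuple R n.+1 A =
  \int[lebesgue_measure]_x lebesgue_tuple R n (tuple_section A x).
Proof.
rewrite /= /lebesgue_cons /pushforward /product_measure1.
by apply: eq_integral => x _ /=; rewrite tuple_sectionE.
Qed.

Lemma measurable_fun_tuple_section A : measurable A ->
  measurable_fun [set: RT] (fun x => lebesgue_tuple R n (tuple_section A x)).
Proof.
move=> /measurable_tuple_cons_preimage mA.
rewrite (_ : (fun x => _) =
    lebesgue_tuple R n \o xsection (@tuple_cons R n @^-1` A)).
  exact: measurable_fun_xsection.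
by apply/funext => x /=; rewrite tuple_sectionE.
Qed.

End tuple_sections.

Lemma measurable_fine_fun d (T : measurableType d) (R : realType)
    (f : T -> \bar R) :
  measurable_fun [set: T] f -> measurable_fun [set: T] (fun x => fine (f x)).
Proof.
by move=> mf; apply: measurableT_comp mf; exact: fine_measurable.
Qed.

Section tuple_cube.
Context (R : realType).
Local Notation RT := (measurableTypeR R).

(** Boundedness is expressed by inclusion in such a cube, which makes volumes finite. *)
Definition cube n (M : R) : set (n.-tuple RT) :=
  [set t | forall i, `|tnth t i| <= M].

Lemma measurable_cube n M : measurable (@cube n M).
Proof.
rewrite (_ : @cube n M = \bigcap_(i in [set` 'I_n])
    ((fun t => tnth t i) @^-1` [set` `[- M, M]])).
  apply: fin_bigcap_measurable => // i _.
  by rewrite -[X in measurable X]setTI; exact: measurable_tnth.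
apply/seteqP; split => t /= h i.
  by move=> _ /=; rewrite in_itv/= -ler_norml.
by have /= := h i isT; rewrite in_itv/= -ler_norml.
Qed.

Lemma lebesgue_tuple_cube n (M : R) : 0 <= M ->
  lebesgue_tuple R n (@cube n M) = ((2 * M) ^+ n)%:E.
Proof.
move=> M0; transitivity (lebesgue_tuple R n
    [set t | forall i, [set` `[- M, M]] (tnth t i)]).
  congr (lebesgue_tuple R n _); apply/seteqP.
  by split=> t /= h i; have := h i; rewrite /= in_itv/= -ler_norml.
rewrite (lebesgue_tuple_box (A := fun=> [set` `[- M, M]]))//.
rewrite (eq_bigr (fun=> (2 * M)%:E)) => [|i _].
  by elim: n => [|n IHn]; rewrite ?big_ord0// big_ord_recl IHn -EFinM -exprS.
rewrite /= lebesgue_measure_itv/= lte_fin.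
case: ltP => [_|MM]; first by rewrite -EFinB; congr EFin; lra.
by congr EFin; lra.
Qed.

Lemma cube_cons n M x (t : n.-tuple RT) :
  cube M (tuple_cons (x, t)) -> `|x| <= M /\ cube M t.
Proof.
move=> h; split; first exact: (h ord0).
by move=> i; have := h (lift ord0 i); rewrite tnthS.
Qed.

Lemma lebesgue_tuple_fin n M (A : set (n.-tuple RT)) :
  0 <= M -> measurable A -> A `<=` cube M ->
  (lebesgue_tuple R n A <= ((2 * M) ^+ n)%:E)%E.
Proof.
move=> M0 mA AM; rewrite -lebesgue_tuple_cube//.
by apply: le_measure; rewrite ?inE//; exact: measurable_cube.
Qed.

(** Differences replace the usual midpoints: for two points of one set, a diameter bound then
    directly places the result in a ball around the origin. *)
Definition half_diff n (s t : n.-tuple RT) : n.-tuple RT :=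
  [tuple (tnth s i - tnth t i) / 2 : RT | i < n].

Lemma half_diff_cons n x y (s t : n.-tuple RT) :
  half_diff (tuple_cons (x, s)) (tuple_cons (y, t)) =
  tuple_cons ((x - y) / 2 : R, half_diff s t).
Proof.
apply: eq_from_tnth => i; rewrite tnth_mktuple.
by case: (unliftP ord0 i) => [j|] ->; rewrite ?tnthS ?tnth_mktuple ?tnth0.
Qed.

End tuple_cube.

(** * Prekopa-Leindler on the line and its consequence for volumes in any dimension *)

(** Dividing [F] and [G] by their suprema reduces to the normalized additive inequality; the
    arithmetic-geometric mean inequality then turns the sum of integrals into a product. *)
Lemma half_diff_integral_le (R : realType) (M N : R) (F G H : R -> R) :
  measurable_fun setT F -> measurable_fun setT G -> measurable_fun setT H ->
  (forall x, 0 <= F x <= N) -> (forall x, 0 <= G x <= N) ->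
  (forall x, 0 <= H x) ->
  (forall x, M < x -> F x = 0) -> (forall x, M < x -> G x = 0) ->
  (forall x y, F x * G y <= H ((x - y) / 2) ^+ 2) ->
  forall I J K : R, 0 <= K ->
    (\int[lebesgue_measure]_x (F x)%:E = I%:E)%E ->
    (\int[lebesgue_measure]_x (G x)%:E = J%:E)%E ->
    (\int[lebesgue_measure]_x (H x)%:E = K%:E)%E -> I * J <= K ^+ 2.
Proof.
move=> mF mG mH FN GN H0 FM GM FGH I J K K0 FI GJ HK.
(* A function vanishing everywhere has integral 0, which makes the claim trivial; otherwise its
   supremum is positive and serves as the scale. *)
have supr (k : R -> R) (k_int : R) : (forall x, 0 <= k x <= N) ->
    (\int[lebesgue_measure]_x (k x)%:E = k_int%:E)%E ->
    k_int = 0 \/ exists a, [/\ 0 < a, forall x, k x <= a &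
      forall t, t < 1 -> exists x, a * t < k x].
  move=> kN kI; have [k0|] := pselect (forall x, k x = 0).
    left; move: kI; under eq_integral do rewrite k0.
    by rewrite integral0 => -[].
  move/existsNP => [x0 /eqP kx0]; right.
  have supk : has_sup (range k).
    split; first by exists (k x0); exists x0.
    by exists N => _ [x _ <-]; case/andP: (kN x).
  have kle x : k x <= sup (range k) by apply: ub_le_sup; [exact: supk.2|exists x].
  have sup0 : 0 < sup (range k).
    by apply: lt_le_trans (kle x0); rewrite lt0r kx0; case/andP: (kN x0).
  exists (sup (range k)); split=> // t t1.
  have e0 : 0 < sup (range k) * (1 - t) by rewrite mulr_gt0// subr_gt0.
  by have [_ [x _ <-] xk] := sup_adherent e0 supk; exists x; lra.
have [->|[a [a0 Fa aF]]] := supr _ _ FN FI; first by rewrite mul0r sqr_ge0.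
have [->|[b [b0 Gb bG]]] := supr _ _ GN GJ; first by rewrite mulr0 sqr_ge0.
(* With the geometric mean as the scale of [H], the pointwise hypothesis survives the rescaling. *)
pose c := Num.sqrt (a * b).
have c0 : 0 < c by rewrite sqrtr_gt0 mulr_gt0.
have cc : c ^+ 2 = a * b by rewrite sqr_sqrtr// mulr_ge0// ltW.
have scale (k : R -> R) (l k_int : R) : measurable_fun setT k -> 0 < l ->
    (forall x, 0 <= k x) ->
    (\int[lebesgue_measure]_x (k x)%:E = k_int%:E)%E ->
    (\int[lebesgue_measure]_x (l^-1 * k x)%:E = (l^-1 * k_int)%:E)%E.
  move=> mk l0 k0 kI; rewrite EFinM -kI -ge0_integralZl//.
  - exact: measurableT_comp.
  - by move=> x _; rewrite lee_fin.
  - by rewrite lee_fin invr_ge0 ltW.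
have mscale (k : R -> R) (l : R) : measurable_fun setT k ->
    measurable_fun setT (fun x => l^-1 * k x).
  by move=> mk; apply: (@measurable_funM _ _ R setT (fun=> l^-1) k).
have := @integral_half_diff_normalized R M (fun x => a^-1 * F x)
  (fun x => b^-1 * G x) (fun x => c^-1 * H x) (mscale _ _ mF) (mscale _ _ mG)
  (mscale _ _ mH).
have F0 x : 0 <= F x by case/andP: (FN x).
have G0 x : 0 <= G x by case/andP: (GN x).
rewrite (scale _ _ _ mF a0 _ FI)// (scale _ _ _ mG b0 _ GJ)//.
rewrite (scale _ _ _ mH c0 _ HK)// -EFinM -EFinD lee_fin => IJK.
have {}IJK : a^-1 * I + b^-1 * J <= 2 * (c^-1 * K).
  apply: IJK.
  - by move=> x; rewrite mulr_ge0 ?invr_ge0 ?(ltW a0)//= ler_pdivrMl// mulr1.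
  - by move=> x; rewrite mulr_ge0 ?invr_ge0 ?(ltW b0)//= ler_pdivrMl// mulr1.
  - by move=> x; rewrite mulr_ge0 ?invr_ge0 ?(ltW c0).
  - by move=> x Mx; rewrite FM// mulr0.
  - by move=> x Mx; rewrite GM// mulr0.
  - by move=> t /aF[x atF]; exists x; rewrite ltr_pdivlMl.
  - by move=> t /bG[x atF]; exists x; rewrite ltr_pdivlMl.
  - move=> x y; rewrite exprMn exprVn cc mulrACA -invfM.
    by rewrite ler_wpM2l// invr_ge0 mulr_ge0// ltW.
have I0 : 0 <= I by rewrite -lee_fin -FI integral_ge0// => x _; rewrite lee_fin.
have J0 : 0 <= J by rewrite -lee_fin -GJ integral_ge0// => x _; rewrite lee_fin.
set u := a^-1 * I in IJK; set v := b^-1 * J in IJK; set w := c^-1 * K in IJK.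
have u0 : 0 <= u by rewrite mulr_ge0// invr_ge0 ltW.
have v0 : 0 <= v by rewrite mulr_ge0// invr_ge0 ltW.
(* From [u + v <= 2 * w], since [4 * u * v = (u + v) ^+ 2 - (u - v) ^+ 2]. *)
have uvw : u * v <= w ^+ 2.
  have : (u + v) ^+ 2 <= (2 * w) ^+ 2.
    by rewrite ler_pXn2r// nnegrE ?addr_ge0//; apply: le_trans IJK; rewrite addr_ge0.
  by have := sqr_ge0 (u - v); rewrite sqrrB sqrrD exprMn; lra.
have -> : I = a * u by rewrite mulVKf// gt_eqF.
have -> : J = b * v by rewrite mulVKf// gt_eqF.
have -> : K = c * w by rewrite mulVKf// gt_eqF.
by rewrite exprMn cc mulrACA ler_pM2l// mulr_gt0.
Qed.

(** A half difference of tuples with heads [x] and [y] has head [(x - y) / 2], so the induction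
    hypothesis on sections is the pointwise hypothesis of [half_diff_integral_le]. The common cube
    makes section volumes finite, bounded, and zero beyond [M]. *)
Lemma lebesgue_tuple_half_diff (R : realType) n (M : R)
    (A B C : set (n.-tuple (measurableTypeR R))) :
  0 <= M -> measurable A -> measurable B -> measurable C ->
  A `<=` cube M -> B `<=` cube M -> C `<=` cube M ->
  (forall s t, A s -> B t -> C (half_diff s t)) ->
  fine (lebesgue_tuple R n A) * fine (lebesgue_tuple R n B) <=
  fine (lebesgue_tuple R n C) ^+ 2.
Proof.
move=> M0; elim: n A B C => [|n IHn] A B C mA mB mC AM BM CM ABC.
  (* In dimension 0 the measure is a unit mass at the empty tuple, so every volume is 0 or 1. *)
  rewrite -![fine (lebesgue_tuple R 0 _)]/(fine (\d_[tuple] _)) !diracE/=.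
  have [A0|A0] := boolP ([tuple] \in A); last by rewrite mul0r sqr_ge0.
  have [B0|B0] := boolP ([tuple] \in B); last by rewrite mulr0 sqr_ge0.
  rewrite mem_set ?mulr1 ?expr1n//.
  have := ABC _ _ (set_mem A0) (set_mem B0).
  by rewrite (tuple0 (half_diff _ _)).
have secM D x : D `<=` cube M -> tuple_section D x `<=` cube M.
  by move=> DM t /DM /cube_cons[].
have secfin D x : measurable D -> D `<=` cube M ->
    lebesgue_tuple R n (tuple_section D x) \is a fin_num.
  move=> mD DM; rewrite ge0_fin_numE//.
  apply: le_lt_trans (ltry _); apply: lebesgue_tuple_fin M0 _ _ => //.
    exact: measurable_tuple_section.
  exact: secM.
have int D : measurable D -> D `<=` cube M ->
    (\int[lebesgue_measure]_x
       (fine (lebesgue_tuple R n (tuple_section D x)))%:E =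
     (fine (lebesgue_tuple R n.+1 D))%:E)%E.
  move=> mD DM; rewrite fineK.
    by rewrite lebesgue_tupleS; apply: eq_integral => x _; rewrite fineK// secfin.
  rewrite ge0_fin_numE//.
  by apply: le_lt_trans (ltry _); apply: lebesgue_tuple_fin M0 _ _.
have bnd D x : measurable D -> D `<=` cube M ->
    0 <= fine (lebesgue_tuple R n (tuple_section D x)) <= (2 * M) ^+ n.
  move=> mD DM; rewrite fine_ge0//= -lee_fin fineK ?secfin//.
  apply: lebesgue_tuple_fin M0 _ _; first exact: measurable_tuple_section.
  exact: secM.
have out D x : D `<=` cube M -> M < x ->
    fine (lebesgue_tuple R n (tuple_section D x)) = 0.
  move=> DM Mx; rewrite (_ : tuple_section D x = set0) ?measure0//.
  rewrite -subset0 => t /DM/cube_cons[xM _].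
  by have := le_lt_trans xM Mx; rewrite ltNge ler_norm.
have mfun D : measurable D -> measurable_fun [set: R]
    (fun x => fine (lebesgue_tuple R n (tuple_section D x))).
  by move=> mD; apply: measurable_fine_fun; exact: measurable_fun_tuple_section.
apply: (@half_diff_integral_le R M ((2 * M) ^+ n) _ _ _
  (mfun _ mA) (mfun _ mB) (mfun _ mC) _ _ _ _ _ _ _ _ _ _
  (int _ mA AM) (int _ mB BM) (int _ mC CM)).
- by move=> x; exact: bnd.
- by move=> x; exact: bnd.
- by move=> x; rewrite fine_ge0.
- by move=> x; exact: out.
- by move=> x; exact: out.
- move=> x y; apply: IHn;
    try solve [exact: measurable_tuple_section | exact: secM].
  by move=> s t As Bt; have := ABC _ _ As Bt; rewrite half_diff_cons.
- by rewrite fine_ge0.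
Qed.

(** * Homotheties and translations in dimension [n] *)

Section affine_tuple.
Context (R : realType).
Local Notation RT := (measurableTypeR R).

Definition affine_tuple n (r : R) (c t : n.-tuple RT) : n.-tuple RT :=
  [tuple r * tnth t i + tnth c i : RT | i < n].

Lemma measurable_affine_tuple n r c :
  measurable_fun [set: n.-tuple RT] (affine_tuple r c).
Proof.
apply/measurable_fun_tnthP => i.
rewrite (_ : _ \o _ = (fun x : RT => r * x + tnth c i) \o (fun t => tnth t i)).
  by apply: measurableT_comp; [exact: measurable_affine|exact: measurable_tnth].
by apply/funext => t /=; rewrite tnth_mktuple.
Qed.

Lemma affine_tuple_cons n r c0 (c : n.-tuple RT) x t :
  affine_tuple r (tuple_cons (c0, c)) (tuple_cons (x, t)) =
  tuple_cons (r * x + c0 : R, affine_tuple r c t).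
Proof.
apply: eq_from_tnth => i; rewrite tnth_mktuple.
by case: (unliftP ord0 i) => [j|] ->; rewrite ?tnthS ?tnth_mktuple ?tnth0.
Qed.

Lemma ge0_integral_affine (r c : R) (f : R -> \bar R) :
  0 < r -> measurable_fun setT f -> (forall x, 0 <= f x)%E ->
  (\int[lebesgue_measure]_x f (r * x + c)%R =
   r^-1%:E * \int[lebesgue_measure]_x f x)%E.
Proof.
move=> r0 mf f0; have rV0 : 0 <= r^-1 by rewrite invr_ge0 ltW.
rewrite -[r^-1]/((NngNum rV0)%:num) -ge0_integral_mscale//.
pose phi (x : RT) : RT := r * x + c.
rewrite -[LHS]/(\int[lebesgue_measure]_(x in phi @^-1` setT) (f \o phi) x)%E.
rewrite -(ge0_integral_pushforward (measurable_affine r c))//.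
apply: eq_measure_integral => [|? A mA _]; first exact: measurable_affine.
apply: etrans (lebesgue_measure_affine c (lt0r_neq0 r0) mA) _.
by rewrite gtr0_norm.
Qed.

(** Induction on the dimension: the section at [x] of the preimage is the preimage of the section at
    [r * x + c0], and each coordinate contributes one factor [r^-1]. *)
Lemma lebesgue_tuple_affine n r c (A : set (n.-tuple RT)) :
  0 < r -> measurable A ->
  (lebesgue_tuple R n (affine_tuple r c @^-1` A) =
   (r^-1 ^+ n)%:E * lebesgue_tuple R n A)%E.
Proof.
move=> r0; elim: n c A => [|n IHn] c A mA.
  rewrite mul1e; congr (lebesgue_tuple R 0 _).
  by apply/seteqP; split=> t /=; rewrite (tuple0 (affine_tuple _ _ _)) (tuple0 t).
have [c0 [c' ->]] : exists c0 c', c = tuple_cons (c0, c').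
  by exists (thead c), [tuple of behead c]; exact: tuple_eta.
have secE x : tuple_section (affine_tuple r (tuple_cons (c0, c')) @^-1` A) x =
    affine_tuple r c' @^-1` tuple_section A (r * x + c0).
  by apply/seteqP; split=> t; rewrite /tuple_section/= affine_tuple_cons.
rewrite !lebesgue_tupleS.
rewrite (eq_integral (fun x : RT =>
    (r^-1 ^+ n)%:E * lebesgue_tuple R n (tuple_section A (r * x + c0)%R))%E);
  last by move=> x _; rewrite secE IHn//; exact: measurable_tuple_section.
rewrite ge0_integralZl//; first last.
- by rewrite lee_fin exprn_ge0// invr_ge0 ltW.
- apply: (@measurableT_comp _ _ _ _ _ _
    (fun x : RT => lebesgue_tuple R n (tuple_section A x))).
    exact: measurable_fun_tuple_section.
  exact: measurable_affine.
rewrite (@ge0_integral_affine r c0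
  (fun x : RT => lebesgue_tuple R n (tuple_section A x)))//.
  by rewrite muleA -EFinM -exprSr.
exact: measurable_fun_tuple_section.
Qed.

End affine_tuple.

(** * Euclidean geometry with squared distances *)

Section euclidean.
Context (R : realType) (d : nat).
Implicit Types (u v w x y z : 'rV[R]_d).

Definition dot u v := \sum_i u 0 i * v 0 i.

Lemma dotC u v : dot u v = dot v u.
Proof. by apply: eq_bigr => i _; rewrite mulrC. Qed.

Lemma dotDl u v w : dot (u + v) w = dot u w + dot v w.
Proof. by rewrite -big_split; apply: eq_bigr => i _; rewrite mxE mulrDl. Qed.

Lemma dotZl a u v : dot (a *: u) v = a * dot u v.
Proof. by rewrite /dot mulr_sumr; apply: eq_bigr => i _; rewrite mxE mulrA. Qed.

Lemma dotDr u v w : dot u (v + w) = dot u v + dot u w.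
Proof. by rewrite dotC dotDl !(dotC u). Qed.

Lemma dotZr a u v : dot u (a *: v) = a * dot u v.
Proof. by rewrite dotC dotZl dotC. Qed.

Lemma dotNl u v : dot (- u) v = - dot u v.
Proof. by rewrite -scaleN1r dotZl mulN1r. Qed.

Lemma dotNr u v : dot u (- v) = - dot u v.
Proof. by rewrite dotC dotNl dotC. Qed.

Lemma dot_ge0 u : 0 <= dot u u.
Proof. by apply: sumr_ge0 => i _; rewrite -expr2 sqr_ge0. Qed.

(** Cauchy-Schwarz, from expanding the squared norm of [b *: u - a *: v]. Stating it with bounds [a]
    and [b] on the norms avoids square roots of [dot]. *)
Lemma dot_le (a b : R) u v : 0 < a -> 0 < b ->
  dot u u <= a ^+ 2 -> dot v v <= b ^+ 2 -> dot u v <= a * b.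
Proof.
move=> a0 b0 ua vb.
have := dot_ge0 (b *: u - a *: v).
rewrite dotDl !dotDr !dotNl !dotNr !dotZl !dotZr (dotC v u) => h.
have ab0 : 0 < a * b by rewrite mulr_gt0.
have hu : b ^+ 2 * dot u u <= b ^+ 2 * a ^+ 2 by rewrite ler_wpM2l// sqr_ge0.
have hv : a ^+ 2 * dot v v <= a ^+ 2 * b ^+ 2 by rewrite ler_wpM2l// sqr_ge0.
rewrite -(ler_pM2l ab0).
by lra.
Qed.

Lemma dot_add_le (a b : R) u v : 0 < a -> 0 < b ->
  dot u u <= a ^+ 2 -> dot v v <= b ^+ 2 ->
  dot (u + v) (u + v) <= (a + b) ^+ 2.
Proof.
move=> a0 b0 ua vb; have := dot_le a0 b0 ua vb.
by rewrite dotDl !dotDr (dotC v u) sqrrD; lra.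
Qed.

Lemma dot_subC u v : dot (u - v) (u - v) = dot (v - u) (v - u).
Proof. by rewrite -[u - v]opprB dotNl dotNr opprK. Qed.

Definition ball2 (r : R) x : set 'rV[R]_d :=
  [set z | dot (z - x) (z - x) <= r ^+ 2].

Lemma translate_ball x : translate (euclidean_ball R d) x = ball2 1 x.
Proof.
have ballE y : euclidean_ball R d y <-> dot y y <= 1.
  rewrite /euclidean_ball /dot/= (eq_bigr (fun i => y 0 i ^+ 2)) => [|i _].
    split=> h.
      by rewrite -[1](expr1n _ 2) -[X in X <= _]sqr_sqrtr ?ler_pXn2r ?nnegrE
        ?sumr_ge0// => *; rewrite sqr_ge0.
    by rewrite -sqrtr1 ler_wsqrtr.
  by rewrite expr2.
rewrite /translate /ball2 expr1n; apply/seteqP; split=> [_ [y /ballE y1 <-]|z/= z1].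
  by rewrite /= addrC addKr.
by exists (z - x); [exact/ballE|rewrite addrC subrK].
Qed.

Lemma ball2_disjoint x y : 4 < dot (x - y) (x - y) ->
  ball2 1 x `&` ball2 1 y = set0.
Proof.
move=> xy; rewrite -subset0 => z [/= zx zy].
have := dot_add_le ltr01 ltr01 _ zy.
rewrite /ball2/= dot_subC in zx.
move=> /(_ _ zx); rewrite addrA subrK => h.
suff : (1 + 1 : R) ^+ 2 = 4 by lra.
by rewrite expr2; lra.
Qed.

Lemma rho2_sqr : rho2 R ^+ 2 = 5 + 2 * Num.sqrt 3.
Proof. by rewrite sqr_sqrtr// addr_ge0// mulr_ge0// sqrtr_ge0. Qed.

(* If y has two neighbours x, x' more than 2 apart, then averaging over them
   gives |z - x|^2 + |z - x'|^2 <= 10 + 2 |(x - y) + (x' - y)|, and the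
   parallelogram law bounds the last norm by sqrt 12. *)
Lemma ball2_two_neighbours x x' y z :
  4 < dot (x - x') (x - x') ->
  dot (x - y) (x - y) <= 4 -> dot (x' - y) (x' - y) <= 4 ->
  ball2 1 y z -> ball2 (rho2 R) x z \/ ball2 (rho2 R) x' z.
Proof.
rewrite /ball2/= rho2_sqr expr1n.
have -> : x - x' = (x - y) - (x' - y) by rewrite opprB addrA subrK.
have -> : z - x = (z - y) - (x - y) by rewrite opprB addrA subrK.
have -> : z - x' = (z - y) - (x' - y) by rewrite opprB addrA subrK.
move: (x - y) (x' - y) (z - y) => u v w uv u4 v4 w1.
have s3 : 0 < Num.sqrt 3 :> R by rewrite sqrtr_gt0.
have ss3 : Num.sqrt 3 ^+ 2 = 3 :> R by rewrite sqr_sqrtr.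
have s12 : dot (u + v) (u + v) <= (2 * Num.sqrt 3) ^+ 2.
  move: uv; rewrite exprMn ss3 !(dotDl, dotDr, dotNl, dotNr) (dotC v u) expr2.
  by lra.
have w1' : dot (- w) (- w) <= 1 ^+ 2 by rewrite dotNl dotNr opprK expr1n.
have t3 : 0 < 2 * Num.sqrt 3 :> R by lra.
have := dot_le ltr01 t3 w1' s12.
rewrite !(dotDl, dotDr, dotNl, dotNr) (dotC u w) (dotC v w) => h.
(* The two squared distances sum to at most [10 + 4 * Num.sqrt 3], twice the square of [rho2], so
   they cannot both exceed that square. *)
case: (leP (dot w w - dot w u + (- dot w u - - dot u u)) (5 + 2 * Num.sqrt 3)) => k.
  by left.
by right; lra.
Qed.

End euclidean.

(** * Volumes of balls and the isodiametric inequality *)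

Section ball_volume.
Context (R : realType) (d : nat).
Local Notation RT := (measurableTypeR R).
Implicit Types (x : 'rV[R]_d) (r : R).

Definition row_of_tuple (t : d.-tuple RT) : 'rV[R]_d := \row_i tnth t i.

Definition row_preimage (E : set 'rV[R]_d) : set (d.-tuple RT) := row_of_tuple @^-1` E.

Lemma volE E : vol E = lebesgue_tuple R d (row_preimage E).
Proof. by []. Qed.

Lemma measurable_ball2 r x : measurable (row_preimage (ball2 r x)).
Proof.
have mf : measurable_fun [set: d.-tuple RT]
    (fun t => dot (row_of_tuple t - x) (row_of_tuple t - x)).
  apply: measurable_sum => i /=.
  rewrite (_ : (fun t => _) =
      (fun t : d.-tuple RT => (tnth t i - x 0 i) * (tnth t i - x 0 i))).
    by apply: measurable_funM; apply: measurable_funB => //; exact: measurable_tnth.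
  by apply/funext => t; rewrite !mxE.
rewrite (_ : row_preimage _ = (fun t => dot (row_of_tuple t - x) (row_of_tuple t - x)
    <= r ^+ 2) @^-1` [set true]).
  rewrite -[X in measurable X]setTI.
  exact: (measurable_fun_ler mf (measurable_cst (r ^+ 2))).
by apply/seteqP; split.
Qed.

Lemma coord_le (r : R) (u : 'rV[R]_d) i :
  0 <= r -> dot u u <= r ^+ 2 -> `|u 0 i| <= r.
Proof.
move=> r0 ur; rewrite -(@ler_pXn2r _ 2)// ?nnegrE// -normrX ger0_norm ?sqr_ge0//.
apply: le_trans ur; rewrite /dot (bigD1 i)//= -expr2 lerDl.
by apply: sumr_ge0 => j _; rewrite -expr2 sqr_ge0.
Qed.

Lemma ball2_cube r x :
  0 <= r -> row_preimage (ball2 r x) `<=` cube (r + \sum_i `|x 0 i|).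
Proof.
move=> r0 t tx i; have := coord_le i r0 tx.
rewrite !mxE => h.
rewrite -[tnth t i](subrK (x 0 i)) (le_trans (ler_normD _ _))// lerD//.
by rewrite (bigD1 i)//= lerDl sumr_ge0.
Qed.

(** The preimage of the ball under [t] to [r * t + x] is the unit ball around 0. *)
Lemma vol_ball2 r x : 0 < r ->
  vol (ball2 r x) = ((r ^+ d)%:E * vol (ball2 1 (0 : 'rV[R]_d)))%E.
Proof.
move=> r0; pose c : d.-tuple RT := [tuple x 0 i : RT | i < d].
have -> : vol (ball2 1 (0 : 'rV[R]_d)) =
    lebesgue_tuple R d (affine_tuple r c @^-1` row_preimage (ball2 r x)).
  rewrite volE; congr (lebesgue_tuple R d _).
  have E (t : d.-tuple RT) :
      row_of_tuple (affine_tuple r c t) - x = r *: row_of_tuple t.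
    by apply/rowP => i; rewrite !mxE !tnth_mktuple addrK.
  apply/seteqP; split=> t;
    rewrite /row_preimage /ball2/= E subr0 dotZl dotZr mulrA -expr2 expr1n;
    by rewrite ger_pMr// exprn_gt0.
rewrite lebesgue_tuple_affine//; last exact: measurable_ball2.
by rewrite muleA -EFinM -exprMn divff ?gt_eqF// expr1n mul1e.
Qed.

Lemma vol_unit_ball : (0 < d)%N -> (0 < vol (ball2 1 (0 : 'rV[R]_d)) < +oo)%E.
Proof.
move=> d0; apply/andP; split; last first.
  apply: le_lt_trans (ltry _).
  apply: lebesgue_tuple_fin (measurable_ball2 _ _) _; last exact: ball2_cube.
  by rewrite addr_ge0// sumr_ge0.
have d1 : 0 < d%:R :> R by rewrite ltr0n.
have dV : 0 < d%:R^-1 :> R by rewrite invr_gt0.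
(* The cube of half-side [1 / d] lies in the unit ball: each of the [d] squared coordinates is at
   most [1 / d ^ 2], hence at most [1 / d]. *)
apply: (@lt_le_trans _ _ (lebesgue_tuple R d (cube d%:R^-1))).
  by rewrite lebesgue_tuple_cube ?ltW// lte_fin exprn_gt0// mulr_gt0.
apply: le_measure; rewrite ?inE; [exact: measurable_cube|exact: measurable_ball2|].
move=> t tc; rewrite /row_preimage /ball2/= subr0 expr1n.
apply: (@le_trans _ _ (\sum_(i < d) d%:R^-1)).
  apply: ler_sum => i _; rewrite !mxE -expr2 -[leLHS]ger0_norm ?sqr_ge0// normrX.
  have ti : `|tnth t i| ^+ 2 <= d%:R^-1 ^+ 2.
    by rewrite ler_pXn2r// ?nnegrE ?(ltW dV)//; exact: tc.
  by apply: le_trans ti _; rewrite expr2 ger_pMl// invf_le1// ler1n.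
by rewrite sumr_const card_ord -[leLHS]mulr_natl divff// gt_eqF.
Qed.

(** Half differences of points of [E] have norm at most [r], so [lebesgue_tuple_half_diff] with both
    sets equal to [E] bounds the square of its volume by that of the ball. *)
Lemma isodiametric (r : R) M (E : set (d.-tuple RT)) : 0 < r -> 0 <= M ->
  measurable E -> E `<=` cube M ->
  (forall s t, E s -> E t ->
    dot (row_of_tuple s - row_of_tuple t) (row_of_tuple s - row_of_tuple t)
      <= (2 * r) ^+ 2) ->
  (lebesgue_tuple R d E <= vol (ball2 r (0 : 'rV[R]_d)))%E.
Proof.
move=> r0 M0 mE EM Er.
have r0' := ltW r0.
have N0 : 0 <= M + r by rewrite addr_ge0.
have cubeS (a b : R) : a <= b -> @cube R d a `<=` cube b.
  by move=> ab t ta i; apply: le_trans ab.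
have EN : E `<=` cube (M + r) by move=> t /EM; apply: cubeS; rewrite lerDl.
have BN : row_preimage (ball2 r 0) `<=` cube (M + r).
  move=> t /(ball2_cube r0'); apply: cubeS.
  by rewrite big1 ?addr0 ?lerDr// => i _; rewrite mxE normr0.
have finE A : measurable A -> A `<=` cube (M + r) ->
    lebesgue_tuple R d A \is a fin_num.
  move=> mA AN; rewrite ge0_fin_numE//.
  by apply: le_lt_trans (ltry _); exact: lebesgue_tuple_fin N0 mA AN.
have mB := measurable_ball2 r 0.
rewrite volE -(fineK (finE _ mE EN)) -(fineK (finE _ mB BN)) lee_fin.
rewrite -(@ler_pXn2r _ 2)// ?nnegrE ?fine_ge0// [leLHS]expr2.
apply: (lebesgue_tuple_half_diff N0) => // s t Es Et.
rewrite /row_preimage /ball2/= subr0.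
have -> : row_of_tuple (half_diff s t) =
    2^-1 *: (row_of_tuple s - row_of_tuple t).
  by apply/rowP => i; rewrite !mxE tnth_mktuple mulrC.
rewrite dotZl dotZr mulrA -expr2 exprVn ler_pdivrMl ?exprn_gt0//.
by rewrite -exprMn; exact: Er.
Qed.

End ball_volume.

(** * Largest independent sets and finite subadditivity *)

(** An independent set of largest cardinality works: a [y] related to all of [J] could be added to
    it, and a related pair [y], [z] violating the last clause could replace [x]. *)
Lemma max_independent (T : finType) (e : rel T) :
  symmetric e -> irreflexive e ->
  exists J : {set T},
    [/\ {in J &, forall x y, x != y -> e x y},
        (forall y, exists2 x, x \in J & ~~ e x y) &
        (forall x y z, x \in J ->
          {in J, forall x', x' != x -> e x' y /\ e x' z} -> ~~ e y z)].
Proof.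
move=> e_sym e_irr.
pose indep (J : {set T}) := [forall x in J, forall y in J, (x != y) ==> e x y].
have indepP (J : {set T}) : reflect {in J &, forall x y, x != y -> e x y} (indep J).
  apply: (iffP forall_inP) => [h x y xJ yJ|h x xJ].
    by have /forall_inP/(_ _ yJ)/implyP := h _ xJ.
  by apply/forall_inP => y yJ; apply/implyP; exact: h.
have indep0 : indep finset.set0 by apply/indepP => x y; rewrite finset.inE.
case: (@arg_maxnP _ finset.set0 indep (fun J : {set T} => #|J|) indep0).
move=> J /indepP Ji Jmax.
have addJ (K : {set T}) y : {in K &, forall x z, x != z -> e x z} ->
    {in K, forall x, e x y} -> (#|K|.+1 <= #|J|)%N.
  move=> Ki Ky; have yK : y \notin K.
    by apply/negP => /Ky; rewrite e_irr.
  have := Jmax (finset.setU (finset.set1 y) K); rewrite cardsU1 yK; apply.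
  apply/indepP => x z /finset.setU1P[->|xK] /finset.setU1P[->|zK].
  - by rewrite eqxx.
  - by move=> _; rewrite e_sym Ky.
  - by move=> _; rewrite Ky.
  - exact: Ki.
exists J; split=> // [y|x y z xJ yz].
  apply/exists_inP; rewrite -negb_forall_in; apply/negP => /forall_inP Jy.
  by have := addJ J y Ji Jy; rewrite ltnn.
apply/negP => eyz.
pose K := finset.setD J (finset.set1 x).
have KJ x' : x' \in K -> x' \in J /\ x' != x by rewrite !finset.inE => /andP[].
have yK : y \notin K.
  by apply/negP => /[dup] /KJ[yJ yx] _; have [] := yz _ yJ yx; rewrite e_irr.
have Ki : {in K &, forall x' y', x' != y' -> e x' y'}.
  by move=> x' y' /KJ[x'J _] /KJ[y'J _]; exact: Ji.
(* Replacing [x] by [y] keeps the cardinality of [J]; adding [z] as well would exceed it. *)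
have : (#|finset.setU (finset.set1 y) K|.+1 <= #|J|)%N.
  apply: (addJ _ z) => [x' y' /finset.setU1P[->|x'K] /finset.setU1P[->|y'K]|
      x' /finset.setU1P[->//|/KJ[x'J x'x]]].
  - by rewrite eqxx.
  - by move=> _; have [y'J y'x] := KJ _ y'K; rewrite e_sym; have [] := yz _ y'J y'x.
  - by move=> _; have [x'J x'x] := KJ _ x'K; have [] := yz _ x'J x'x.
  - exact: Ki.
  - by have [] := yz _ x'J x'x.
by rewrite cardsU1 yK (cardsD1 x J) xJ ltnn.
Qed.

Lemma measure_bigsetU_le dd (T : measurableType dd) (R : realType)
    (mu : {measure set T -> \bar R}) (I : finType) (P : pred I)
    (U : I -> set T) :
  (forall i, measurable (U i)) ->
  (mu (\big[setU/set0]_(i | P i) U i) <= \sum_(i | P i) mu (U i))%E.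
Proof.
move=> mU.
(* Measurability is carried along because binary subadditivity asks for it at each stage. *)
suff [] : measurable (\big[setU/set0]_(i | P i) U i) /\
  (mu (\big[setU/set0]_(i | P i) U i) <= \sum_(i | P i) mu (U i))%E by [].
apply: (big_ind2 (fun X s => measurable X /\ (mu X <= s)%E)) =>
  [|X s Y t [mX Xs] [mY Yt]|i _].
- by split; [exact: measurable0|rewrite measure0].
- split; first exact: measurableU.
  by apply: le_trans (measureU2 _ _ _) _ => //; exact: leeD.
- by split.
Qed.

(** * Covering the union by clusters and enlarged balls *)

Section covering.
Context (R : realType) (d n : nat) (p : 'I_n -> 'rV[R]_d).
Local Notation RT := (measurableTypeR R).
Local Notation B r i := (row_preimage (ball2 r (p i))).

(** Distance greater than 2, that is, disjointness of the two closed unit balls. *)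
Definition far (i j : 'I_n) : bool := 4 < dot (p i - p j) (p i - p j).

Lemma far_sym : symmetric far.
Proof. by move=> i j; rewrite /far dot_subC. Qed.

Lemma far_irr : irreflexive far.
Proof.
by move=> i; rewrite /far subrr -(scale0r (0 : 'rV[R]_d)) dotZl mul0r ltrn0.
Qed.

(** Two points of the union are at distance at most [1 + 2 + 1 = 4], through the centres of their
    balls, so the isodiametric inequality applies with radius 2. *)
Lemma lebesgue_tuple_cluster (Y : {pred 'I_n}) :
  (forall i j, i \in Y -> j \in Y -> ~~ far i j) ->
  (lebesgue_tuple R d (\big[setU/set0]_(i in Y) B 1 i) <=
   (2 ^+ d)%:E * vol (ball2 1 (0 : 'rV[R]_d)))%E.
Proof.
move=> Yclose; rewrite -(vol_ball2 0)//.
have inY t : (\big[setU/set0]_(i in Y) B 1 i) t -> exists2 i, i \in Y & B 1 i t.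
  by rewrite -bigcup_pred => -[i Yi ti]; exists i.
pose M := 1 + \sum_i \sum_k `|p i 0 k|.
apply: (@isodiametric _ _ _ M) => //.
- by rewrite addr_ge0// sumr_ge0// => i _; rewrite sumr_ge0.
- by apply: bigsetU_measurable => i _; exact: measurable_ball2.
- move=> t /inY[i _ /(ball2_cube ler01) ti] k; apply: le_trans (ti k) _.
  rewrite lerD2l (bigD1 i)//= lerDl sumr_ge0// => j _; exact: sumr_ge0.
move=> s t /inY[i Yi si] /inY[j Yj tj].
have -> : row_of_tuple s - row_of_tuple t =
    (row_of_tuple s - p i) + (p i - p j) + (p j - row_of_tuple t).
  by rewrite addrA -(addrA _ _ (p j)) !subrK.
have -> : 2 * 2 = 1 + 2 + 1 :> R by lra.
apply: dot_add_le => //; last by rewrite dot_subC.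
apply: dot_add_le => //.
by have := Yclose _ _ Yi Yj; rewrite /far -leNgt expr2; lra.
Qed.

Lemma rho2_gt0 : 0 < rho2 R.
Proof. by rewrite sqrtr_gt0 addr_gt0// mulr_gt0// sqrtr_gt0. Qed.

(** Each member of [J] accounts for its ball of radius [rho2] and for its cluster, and these sets
    together cover the union. *)
Lemma covering_bound (J : {set 'I_n}) (v : R) :
  vol (ball2 1 (0 : 'rV[R]_d)) = v%:E ->
  {in J &, forall x y, x != y -> far x y} ->
  (forall y, exists2 x, x \in J & ~~ far x y) ->
  (forall x y z, x \in J ->
    {in J, forall x', x' != x -> far x' y /\ far x' z} -> ~~ far y z) ->
  (lebesgue_tuple R d (\bigcup_i B 1 i) <=
   (#|J|%:R * ((2 ^+ d + rho2 R ^+ d) * v))%:E)%E.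
Proof.
move=> vE Jfar Jnear Jmax.
(* The cluster of [x]: the indices with no neighbour in [J] other than possibly [x]. *)
pose Y x : {pred 'I_n} := [pred i | [forall x' in J, (x' != x) ==> far x' i]].
pose E x := \big[setU/set0]_(i in Y x) B 1 i.
have mB r i : measurable (B r i) by exact: measurable_ball2.
have mE x : measurable (E x) by apply: bigsetU_measurable.
have Efar x : x \in J -> forall i j, i \in Y x -> j \in Y x -> ~~ far i j.
  move=> xJ i j /forall_inP iY /forall_inP jY; apply: (Jmax x) => // x' x'J x'x.
  by have := iY _ x'J; have := jY _ x'J; rewrite x'x.
have cover : \bigcup_i B 1 i `<=`
    \big[setU/set0]_(x in J) (B (rho2 R) x `|` E x).
  move=> t [i _ ti]; have [x xJ xi] := Jnear i.
  rewrite -bigcup_pred/=.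
  (* Either [i] belongs to the cluster of its neighbour [x], or it has a second neighbour [x'] and
     [t] falls in one of the two enlarged balls. *)
  have [iY|] := boolP (i \in Y x).
    by exists x => //; right; rewrite /E -bigcup_pred; exists i.
  rewrite inE negb_forall_in => /exists_inP[x' x'J].
  rewrite negb_imply => /andP[x'x x'i].
  have := @ball2_two_neighbours _ _ (p x) (p x') (p i) (row_of_tuple t).
  case=> //; first by have := Jfar _ _ xJ x'J; rewrite eq_sym; exact.
  - by rewrite leNgt.
  - by rewrite leNgt.
  - by move=> tx; exists x => //; left.
  - by move=> tx; exists x' => //; left.
have mBE x : measurable (B (rho2 R) x `|` E x) by exact: measurableU.
apply: (@le_trans _ _ (\sum_(x in J) ((2 ^+ d + rho2 R ^+ d) * v)%:E)%E).
  apply: (@le_trans _ _ (lebesgue_tuple R d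
      (\big[setU/set0]_(x in J) (B (rho2 R) x `|` E x)))).
    apply: le_measure => //; rewrite inE; last exact: bigsetU_measurable.
    by apply: fin_bigcup_measurable.
  apply: le_trans (measure_bigsetU_le _ _ mBE) _; apply: lee_sum => x xJ.
  apply: le_trans (measureU2 _ (mB _ _) (mE _)) _.
  rewrite [2 ^+ d + _]addrC mulrDl EFinD; apply: leeD.
    rewrite -[X in (X <= _)%E]/(vol (ball2 (rho2 R) (p x))).
    by rewrite vol_ball2 ?vE ?EFinM ?rho2_gt0.
  by rewrite EFinM -vE; apply: lebesgue_tuple_cluster; exact: Efar.
by rewrite sumEFin sumr_const mulr_natl.
Qed.

Lemma packing_volume (J : {set 'I_n}) (v : R) :
  vol (ball2 1 (0 : 'rV[R]_d)) = v%:E ->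
  {in J &, forall x y, x != y -> far x y} ->
  lebesgue_tuple R d (\big[setU/set0]_(i in J) B 1 i) = (#|J|%:R * v)%:E.
Proof.
move=> vE Jfar; rewrite measure_bigsetU_ord_cond//.
- transitivity (\sum_(i in J) v%:E)%E; last by rewrite sumEFin sumr_const mulr_natl.
  apply: eq_bigr => i _.
  by rewrite -[LHS]/(vol (ball2 1 (p i))) vol_ball2// expr1n mul1e.
- by move=> i _; exact: measurable_ball2.
move=> i j /= iJ jJ [t [ti tj]]; apply/eqP/negPn/negP => ij.
have := ball2_disjoint (Jfar _ _ iJ jJ ij); rewrite -subset0; apply.
by split; [exact: ti|exact: tj].
Qed.

End covering.

(** * The ratio for Euclidean balls, numerical bounds and conclusion *)

(** The balls selected by [J] are disjoint, with total volume [#|J| * v], while [covering_bound]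
    limits the whole union to that volume times the inverse of the claimed ratio. *)
Lemma covering_ratio_ball (R : realType) (d : nat) : (0 < d)%N ->
  covering_ratio (euclidean_ball R d) (2 ^+ d + rho2 R ^+ d)^-1.
Proof.
move=> d0.
have K0 : 0 < 2 ^+ d + rho2 R ^+ d by rewrite addr_gt0// exprn_gt0// rho2_gt0.
split=> [|C finC CK]; first by rewrite invr_ge0 ltW.
have [v vE] : exists v : R, vol (ball2 1 (0 : 'rV[R]_d)) = v%:E.
  have /andP[_ voo] := vol_unit_ball R d0.
  by exists (fine (vol (ball2 1 (0 : 'rV[R]_d)))); rewrite fineK// ge0_fin_numE.
(* Listing the collection gives a finite index type, with one centre chosen for each index. *)
have /finite_seqP[s Cs] := finC.
pose A i := tnth (in_tuple s) i.
have CA i : C (A i) by rewrite Cs; exact: mem_tnth.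
have /choice[p pA] i : exists x, A i = ball2 1 x.
  by have [x Ax] := CK _ (CA i); exists x; rewrite Ax translate_ball.
have [J [Jfar Jnear Jmax]] := max_independent (far_sym p) (far_irr p).
exists [set A j | j in [set` J]]; split.
- by move=> _ [j _ <-].
- move=> _ _ [i iJ <-] [j jJ <-] [z [/= zi zj]].
  have [->//|ij] := eqVneq i j.
  have := ball2_disjoint (Jfar _ _ iJ jJ ij); rewrite -subset0.
  by case/(_ z); split; rewrite -pA.
have -> : vol (\bigcup_(X in [set A j | j in [set` J]]) X) =
    (#|J|%:R * v)%:E.
  rewrite -(packing_volume vE Jfar) volE; congr (lebesgue_tuple R d _).
  rewrite -bigcup_pred bigcup_image; apply/seteqP.
  by split=> t [i iJ ti]; exists i => //; move: ti; rewrite /row_preimage/= pA.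
have : (vol (\bigcup_(X in C) X) <=
    (#|J|%:R * ((2 ^+ d + rho2 R ^+ d) * v))%:E)%E.
  apply: le_trans (covering_bound vE Jfar Jnear Jmax).
  rewrite volE (_ : row_preimage _ = \bigcup_i row_preimage (ball2 1 (p i)))//.
  apply/seteqP; split=> t.
    move=> [X]; rewrite Cs => /seq_tnthP[i ->] ti.
    by exists i => //; rewrite /row_preimage/= -pA.
  by move=> [i _]; rewrite /row_preimage/= -pA => ti; exists (A i).
move=> h; apply: le_trans (lee_wpmul2l _ h) _; first by rewrite lee_fin invr_ge0 ltW.
by rewrite -EFinM lee_fin mulrCA mulKf// gt_eqF.
Qed.

Lemma rho2_bounds (R : realType) :
  2 + 90 / 10 ^+ 2 + 93 / 10 ^+ 4 <= rho2 R
    < 2 + 90 / 10 ^+ 2 + 94 / 10 ^+ 4.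
Proof.
have -> : 10 ^+ 4 = 100 * 100 :> R.
  by rewrite (exprD _ 2 2) expr2 -!natrM.
have -> : 10 ^+ 2 = 100 :> R by rewrite expr2 -natrM.
have : Num.sqrt 3 ^+ 2 = 3 :> R by rewrite sqr_sqrtr.
have := rho2_sqr R; have := ltW (rho2_gt0 R); have := sqrtr_ge0 (3 : R).
move: (Num.sqrt 3) (rho2 R) => s r s0 r0 r2 s3.
(* Continued fraction convergents of the square root of 3: [265 ^ 2 = 3 * 153 ^ 2 - 2] and
   [97 ^ 2 = 3 * 56 ^ 2 + 1]. They are close enough to fix four decimals of [rho2]. *)
have s1 : 265 / 153 <= s by rewrite leNgt; apply/negP => h; nra.
have s2 : s <= 97 / 56 by rewrite leNgt; apply/negP => h; nra.
apply/andP; split.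
  by rewrite leNgt; apply/negP => h; nra.
by rewrite ltNge; apply/negP => h; nra.
Qed.

Theorem theorem1p1 (R : realType) :
  [/\ 2 + 90 / 10 ^+ 2 + 93 / 10 ^+ 4 <= rho2 R
        < 2 + 90 / 10 ^+ 2 + 94 / 10 ^+ 4,
      rho2 R < 3 &
      forall d : nat, (1 <= d)%N ->
        fconst (euclidean_ball R d) >= (2 ^+ d + rho2 R ^+ d)^-1].
Proof.
have rb := rho2_bounds R; split=> //.
  by have /andP[_] := rb; lra.
(* Positive finite volume of the ball makes the set of ratios bounded, so its supremum dominates the
   ratio found. *)
move=> d d1; apply: fconst_max; last exact: covering_ratio_ball.
suff -> : euclidean_ball R d = ball2 1 0 by exact: vol_unit_ball.
rewrite -translate_ball /translate.
by under eq_imagel do rewrite add0r; rewrite image_id.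
Qed.
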